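(* Let $A\in\mathbb{R}^{n\times n}$ be a symmetric matrix, let $\|\cdot\|$ be any unitarily invariant norm on $n\times n$ matrices, and let $S$ be an arbitrary set of multisets of $n$ real numbers. Consider the optimization problem $$\min_{X}\ \|X-A\|\quad\text{subject to}\quad \mathrm{Eig}(X)\in S,\quad X=X^T,\ X\in\mathbb{R}^{n\times n},$$ where $\mathrm{Eig}(X)$ is the multiset of eigenvalues of $X$. If this problem has at least one optimal solution, then it has an optimal solution $\widehat X$ with the same eigenvectors as $A$.
   Context: A norm on (complex) $n\times n$ matrices is unitarily invariant if $\|UMV\|=\|M\|$ for all matrices $M$ and all unitary $U,V$. $\mathrm{Eig}(X)$ counts eigenvalues with multiplicity. ''$\widehat X$ has the same eigenvectors as $A$'' means that there is an orthonormal basis of $\mathbb{R}^n$ each of whose elements is an eigenvector of both $A$ and $\widehat X$. *)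

(* Defs.v *)
From HB Require Import structures.
From mathcomp Require Import all_boot all_order all_algebra.
From mathcomp Require Import spectral finmap multiset.
From mathcomp Require Import polyorder polyrcf complex.
From mathcomp Require Import classical_sets reals.

Set Implicit Arguments.
Unset Strict Implicit.
Unset Printing Implicit Defensive.

Import Order.TTheory GRing.Theory Num.Theory.

Local Open Scope ring_scope.
Local Open Scope mset_scope.
Local Open Scope complex_scope.

(* Nonnegativity of N follows from the triangle inequality and homogeneity. *)
Record is_matrix_norm (R : realType) (n : nat) (N : 'M[R[i]]_n -> R) : Prop :=
  IsMatrixNorm {
    matrix_norm_triangle : forall M M', N (M + M') <= N M + N M';
    matrix_norm_homogeneous : forall (c : R[i]) M,
      N (c *: M) = ComplexField.Normc.normc c * N M;
    matrix_norm_definite : forall M, N M = 0 -> M = 0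
  }.

Definition unitarily_invariant (R : realType) (n : nat) (N : 'M[R[i]]_n -> R) :=
  forall U M V : 'M[R[i]]_n,
    U \is unitarymx -> V \is unitarymx -> N (U *m M *m V) = N M.

Definition complexify (R : realType) (n : nat) (M : 'M[R]_n) : 'M[R[i]]_n :=
  map_mx (real_complex R) M.

Fact Eig_key : unit. Proof. exact: tt. Qed.

(* Only the real eigenvalues are recorded; this is the full spectrum for the
   symmetric matrices to which it is applied.  The multiplicity is the algebraic
   one. *)
Definition Eig (R : realType) (n : nat) (X : 'M[R]_n) : {mset R} :=
  [fsfun[Eig_key] a in [fset x in rootsR (char_poly X)]%fset =>
    \mu_a (char_poly X)].

Lemma EigE (R : realType) (n : nat) (X : 'M[R]_n) (a : R) :
  Eig X a = \mu_a (char_poly X).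
Proof.
have p0 : char_poly X != 0 by apply: monic_neq0; apply: char_poly_monic.
rewrite /Eig fsfun_fun !inE /=.
case: ifPn => // a_notin; apply/esym/muNroot.
by move: a_notin; rewrite -roots_on_rootsR // in_itv.
Qed.

Definition feasible (R : realType) (n : nat) (S : set {mset R}) (X : 'M[R]_n) :
  Prop := S (Eig X) /\ X = X^T.

Definition optimal_solution (R : realType) (n : nat) (N : 'M[R[i]]_n -> R)
    (A : 'M[R]_n) (S : set {mset R}) (X : 'M[R]_n) : Prop :=
  feasible S X /\
  forall Y : 'M[R]_n, feasible S Y ->
    N (complexify (X - A)) <= N (complexify (Y - A)).

Definition eigenvector (R : realType) (n : nat) (M : 'M[R]_n) (v : 'cV[R]_n) :
  Prop := v != 0 /\ exists a : R, M *m v = a *: v.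

Definition orthonormal_basis (R : realType) (n : nat) (B : n.-tuple 'cV[R]_n) :
  Prop :=
  basis_of fullv B /\
  forall i j : 'I_n, ((tnth B i)^T *m tnth B j) 0 0 = (i == j)%:R.

Definition same_eigenvectors (R : realType) (n : nat) (X A : 'M[R]_n) : Prop :=
  exists2 B : n.-tuple 'cV[R]_n, orthonormal_basis B &
    forall v, v \in B -> eigenvector A v /\ eigenvector X v.

(* Main.v *)
(** Mirsky's argument: for symmetric [A] and [X] with decreasingly sorted
    eigenvalues [a] and [x], [N (diag (x - a)) <= N (X - A)].  Hence moving the
    sorted spectrum of an optimal [X] onto an eigenbasis of [A] keeps the spectrum
    and does not increase the distance to [A].  By Lidskii's theorem [x - a] is
    majorized by the spectrum [d] of [X - A], so [x - a] is reached from [d] by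
    successive averaging with transpositions; a unitarily invariant norm, which
    restricts on diagonal matrices to a convex permutation-invariant function,
    does not increase under such averaging. *)

Require Import Defs.
From mathcomp Require Import all_boot all_order all_algebra all_fingroup.
From mathcomp Require Import ring lra zify.
From mathcomp Require Import spectral finmap multiset complex classical_sets reals.

Set Implicit Arguments.
Unset Strict Implicit.
Unset Printing Implicit Defensive.

Import Order.TTheory GRing.Theory Num.Theory.

Local Open Scope ring_scope.
Local Open Scope mset_scope.
Local Open Scope complex_scope.

(** * Quadratic forms and orthogonal conjugates of diagonal matrices *)

Lemma dot_diagE (F : comNzRingType) (n : nat) (a v : 'rV[F]_n) :
  (v *m diag_mx a *m v^T) 0 0 = \sum_i a 0 i * v 0 i ^+ 2.
Proof.
rewrite mul_mx_diag mxE; apply: eq_bigr => i _.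
by rewrite !mxE mulrAC mulrC expr2.
Qed.

Lemma dotE (F : comNzRingType) (n : nat) (v : 'rV[F]_n) :
  (v *m v^T) 0 0 = \sum_i v 0 i ^+ 2.
Proof. by rewrite mxE; apply: eq_bigr => i _; rewrite !mxE expr2. Qed.

Lemma dot_gt0 (F : realDomainType) (n : nat) (v : 'rV[F]_n) :
  v != 0 -> 0 < (v *m v^T) 0 0.
Proof.
move=> /rV0Pn[i vi]; rewrite dotE (bigD1 i) //=.
rewrite ltr_wpDr ?sumr_ge0 // => [j _|]; first exact: sqr_ge0.
by rewrite lt_def sqrf_eq0 vi sqr_ge0.
Qed.

Lemma orthogonal_mul (F : comNzRingType) (n : nat) (P Q : 'M[F]_n) :
  P *m P^T = 1%:M -> Q *m Q^T = 1%:M -> (P *m Q) *m (P *m Q)^T = 1%:M.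
Proof. by move=> hP hQ; rewrite trmx_mul -mulmxA (mulmxA Q) hQ mul1mx. Qed.

(** For orthogonal [Q] this is the symmetric matrix whose eigenvectors are the rows of [Q], with
    eigenvalue [a 0 i] on row [i]. *)
Definition diag_conj (F : comNzRingType) (n : nat) (Q : 'M[F]_n) (a : 'rV[F]_n) :=
  Q^T *m diag_mx a *m Q.

Lemma diag_conj_sym (F : comNzRingType) (n : nat) (Q : 'M[F]_n) (a : 'rV[F]_n) :
  diag_conj Q a = (diag_conj Q a)^T.
Proof. by rewrite /diag_conj !trmx_mul trmxK tr_diag_mx mulmxA. Qed.

Lemma diag_conjD (F : comNzRingType) (n : nat) (Q : 'M[F]_n) (a b : 'rV[F]_n) :
  diag_conj Q (a + b) = diag_conj Q a + diag_conj Q b.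
Proof. by rewrite /diag_conj raddfD mulmxDr mulmxDl. Qed.

Lemma diag_conjB (F : comNzRingType) (n : nat) (Q : 'M[F]_n) (a b : 'rV[F]_n) :
  diag_conj Q (a - b) = diag_conj Q a - diag_conj Q b.
Proof. by rewrite /diag_conj raddfB mulmxBr mulmxBl. Qed.

Lemma diag_conj_const (F : comNzRingType) (n : nat) (Q : 'M[F]_n) (c : F) :
  Q *m Q^T = 1%:M -> diag_conj Q (const_mx c) = c%:M.
Proof.
by move=> hQ; rewrite /diag_conj diag_const_mx mul_mx_scalar -scalemxAl
  (mulmx1C hQ) scalemx1.
Qed.

Lemma mxtrace_diag_conj (F : comNzRingType) (n : nat) (Q : 'M[F]_n)
    (a : 'rV[F]_n) :
  Q *m Q^T = 1%:M -> \tr (diag_conj Q a) = \sum_i a 0 i.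
Proof.
by move=> hQ; rewrite /diag_conj mxtrace_mulC mulmxA hQ mul1mx mxtrace_diag.
Qed.

Lemma quad_diag_conj (F : comNzRingType) (n : nat) (Q : 'M[F]_n)
    (a v : 'rV[F]_n) :
  (v *m diag_conj Q a *m v^T) 0 0 = \sum_i a 0 i * (v *m Q^T) 0 i ^+ 2.
Proof. by rewrite -dot_diagE /diag_conj trmx_mul trmxK !mulmxA. Qed.

(** * The real spectral theorem *)

(** The orthogonal reflection along [v - e] sends the first basis vector [e] to [v], which is then
    its first row. This completes a unit eigenvector to an orthonormal basis. *)
Lemma householder (F : realFieldType) (n : nat) (v : 'rV[F]_(1 + n)) :
  v *m v^T = 1%:M ->
  exists2 H : 'M[F]_(1 + n), H *m H^T = 1%:M & row 0 H = v.
Proof.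
move=> v1; pose e : 'rV[F]_(1 + n) := row 0 1%:M.
have [->|w0] := eqVneq v e; first by exists 1%:M => //; rewrite trmx1 mulmx1.
pose w := v - e; pose c := (w *m w^T) 0 0.
have c_gt0 : 0 < c by apply: dot_gt0; rewrite subr_eq0.
have cE : w *m w^T = c%:M by rewrite [LHS]mx11_scalar.
have eE m (M : 'M[F]_(1 + n, m)) : e *m M = row 0 M.
  by rewrite /e -row_mul mul1mx.
have veT : v *m e^T = (v 0 0)%:M.
  rewrite [LHS]mx11_scalar -(trmxK v) -trmx_mul eE.
  by congr _%:M; rewrite !mxE.
have evT : e *m v^T = (v 0 0)%:M.
  by rewrite -(trmxK (e *m _)) trmx_mul trmxK veT tr_scalar_mx.
have eeT : e *m e^T = 1%:M.
  by rewrite eE [LHS]mx11_scalar; congr _%:M; rewrite !mxE.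
have cv : c = 2 - 2 * v 0 0.
  rewrite /c /w linearB /= mulmxBl !mulmxBr v1 eeT evT veT !mxE /=.
  by rewrite !mulr1n; ring.
have ewT : e *m w^T = (v 0 0 - 1)%:M.
  by rewrite /w linearB /= mulmxBr eeT evT -raddfB.
pose K := w^T *m w.
have KK : K *m K = c *: K.
  by rewrite /K mulmxA -(mulmxA w^T) cE mul_mx_scalar -scalemxAl.
exists (1%:M - (2 / c) *: K).
  have -> : (1%:M - (2 / c) *: K)^T = 1%:M - (2 / c) *: K.
    by rewrite [LHS]linearB [X in _ - X]linearZ /= trmx1 trmx_mul trmxK.
  rewrite mulmxBr mulmx1 -scalemxAr mulmxBl mul1mx -scalemxAl KK !scalerA.
  rewrite scalerBr scalerA.
  have -> : 2 / c * (2 / c * c) = 2 / c + 2 / c by field; rewrite gt_eqF.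
  by rewrite scalerDl opprB addrK subrK.
rewrite -eE mulmxBr mulmx1 -scalemxAr mulmxA ewT mul_scalar_mx scalerA.
have -> : 2 / c * (v 0 0 - 1) = -1 by rewrite cv; field; rewrite -cv gt_eqF.
by rewrite scaleN1r opprK /w addrC subrK.
Qed.

(** A complex eigenvalue exists by algebraic closure; it is real because a real symmetric matrix is
    Hermitian. *)
Lemma symmetric_eigenvalue (R : rcfType) (n : nat) (A : 'M[R]_n.+1) :
  A = A^T -> exists a : R, eigenvalue A a.
Proof.
move=> hA; pose AC : 'M[R[i]]_n.+1 := map_mx (real_complex R) A.
have [z hz] := eigenvalue_closed AC (ltn0Sn n).
have ACh : (map_mx Num.conj AC)^T = AC.
  apply/matrixP => i j; rewrite !mxE {1}hA mxE.
  by apply/eqP; rewrite eq_complex /= oppr0 !eqxx.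
have zr : Num.conj z = z.
  have /eigenvalueP[v vA v0] := hz.
  have h : v *m AC *m (map_mx Num.conj v)^T = z *: (v *m (map_mx Num.conj v)^T).
    by rewrite vA scalemxAl.
  have vK : (map_mx Num.conj (map_mx Num.conj v)^T)^T = v.
    by apply/matrixP => i j; rewrite !mxE conjCK.
  (* Conjugate transposition fixes the left side of [h] and conjugates the factor [z] on the right;
     the squared length of [v] is nonzero and cancels. *)
  have := congr1 (fun M => (map_mx Num.conj M)^T) h.
  rewrite map_mxZ !map_mxM linearZ /= !trmx_mul vK ACh mulmxA h.
  move=> /matrixP/(_ 0 0); rewrite [LHS]mxE [RHS]mxE => /esym e.
  apply: (mulIf _ e); rewrite map_trmx.
  by have := dotmx_is_dotmx v0; rewrite dotmxE => /lt0r_neq0.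
have zE : z = (complex.Re z)%:C.
  case: z zr {hz} => x y /eqP; rewrite eq_complex /= eqxx /= eq_sym => h.
  apply/eqP; rewrite eq_complex /= eqxx /=; apply/eqP; lra.
by exists (complex.Re z); rewrite -(eigenvalue_map (real_complex R)) /= -zE.
Qed.

(** Induction on the dimension: in an orthonormal basis starting with a unit eigenvector, the matrix
    splits into a 1 by 1 block and a smaller symmetric block. *)
Lemma symmetric_diagonalization (R : rcfType) (n : nat) (A : 'M[R]_n) :
  A = A^T -> exists Q (a : 'rV[R]_n),
    Q *m Q^T = 1%:M /\ A = diag_conj Q a.
Proof.
elim: n A => [|n IH] A hA.
  by exists 1%:M, 0; split; [apply/matrixP => -[] | apply/matrixP => -[]].
have [a /eigenvalueP[u uA u0]] := symmetric_eigenvalue hA.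
pose v : 'rV[R]_(1 + n) := (Num.sqrt ((u *m u^T) 0 0))^-1 *: u.
have uu := dot_gt0 u0.
have v1 : v *m v^T = 1%:M.
  rewrite [LHS]mx11_scalar /v linearZ /= -scalemxAl -scalemxAr scalerA.
  by rewrite -invfM -expr2 sqr_sqrtr ?ltW // mxE mulVf ?gt_eqF.
have vA : v *m A = a *: v by rewrite /v -scalemxAl uA scalerA mulrC -scalerA.
have [H hH Hv] := householder v1.
pose B : 'M[R]_(1 + n) := H *m A *m H^T.
have Bsym : B^T = B by rewrite /B !trmx_mul trmxK -hA mulmxA.
have Brow : row 0 B = a *: row 0 1%:M.
  by rewrite /B !row_mul Hv vA -scalemxAl -hH row_mul Hv.
have Bur : ursubmx B = 0.
  apply/matrixP => i j; rewrite [RHS]mxE !mxE.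
  have := congr1 (fun M : 'rV_(1 + n) => M 0 (rshift 1 j)) Brow.
  rewrite ord1 !mxE => h.
  by rewrite (_ : lshift n 0 = 0) ?h ?mulr0 //; apply: val_inj.
have BE : B = block_mx (ulsubmx B) 0 0 (drsubmx B).
  by rewrite -{1}(submxK B) -{3}Bsym -trmx_ursub Bur trmx0.
have Bdr : drsubmx B = (drsubmx B)^T by rewrite trmx_drsub Bsym.
have [Q [d [hQ dE]]] := IH _ Bdr.
pose P : 'M[R]_(1 + n) := block_mx 1%:M 0 0 Q.
pose b : 'rV[R]_(1 + n) := row_mx (const_mx (B 0 0)) d.
have hP : P *m P^T = 1%:M.
  rewrite /P tr_block_mx mulmx_block !trmx0 !trmx1.
  rewrite !mulmx0 !mul0mx !addr0 !add0r.
  by rewrite mulmx1 hQ -scalar_mx_block.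
have hB : B = diag_conj P b.
  rewrite /diag_conj /b diag_mx_row /P tr_block_mx !mulmx_block !trmx0 !trmx1.
  rewrite !(mulmx0, mul0mx, addr0, add0r) mulmx1 mul1mx -[_ *m Q]dE.
  rewrite (_ : diag_mx _ = ulsubmx B) -?BE // [RHS]mx11_scalar [LHS]mx11_scalar.
  rewrite [ulsubmx B 0 0]mxE [usubmx B 0 _]mxE.
  rewrite (_ : lshift n (0 : 'I_1) = 0) ?mxE ?eqxx ?mulr1n //.
  exact: val_inj.
exists (P *m H), b; split; first exact: orthogonal_mul.
have -> : A = H^T *m B *m H.
  by rewrite /B !mulmxA (mulmx1C hH) mul1mx -mulmxA (mulmx1C hH) mulmx1.
by rewrite hB /diag_conj trmx_mul !mulmxA.
Qed.

(** * Sorted spectra and eigenvalue inequalities *)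

Definition nonincreasing (R : numDomainType) (n : nat) (a : 'rV[R]_n) :=
  forall i j : 'I_n, (i <= j)%N -> a 0 j <= a 0 i.

Lemma nonincreasing_perm (R : realDomainType) (n : nat) (a : 'rV[R]_n) :
  exists s : {perm 'I_n}, nonincreasing (col_perm s a).
Proof.
pose t := [tuple a 0 i | i < n].
have tE i : tnth t i = a 0 i by rewrite tnth_mktuple.
have tot : total (fun x y : R => y <= x) by move=> x y; exact: le_total.
have sz : size (sort (fun x y : R => y <= x) t) == n.
  by rewrite size_sort size_tuple.
have /tuple_permP[s sE] : perm_eq (Tuple sz) t by rewrite /= perm_sort.
exists s => i j ij.
have nE k : col_perm s a 0 k = nth 0 (sort (fun x y : R => y <= x) t) k.
  by rewrite [sort _ _]sE -(tnth_nth 0) tnth_mktuple tE mxE.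
rewrite !nE.
apply: (@sorted_leq_nth _ (fun x y : R => y <= x)) => //.
- by move=> x y z yx zy; exact: le_trans zy yx.
- exact: sort_sorted.
- by rewrite inE (eqP sz).
- by rewrite inE (eqP sz).
Qed.

Lemma diag_mx_col_perm (R : pzSemiRingType) (n : nat) (s : {perm 'I_n})
    (a : 'rV[R]_n) :
  diag_mx a = (perm_mx s)^T *m diag_mx (col_perm s a) *m perm_mx s.
Proof.
rewrite tr_perm_mx -row_permE -[X in _ *m perm_mx X]invgK -col_permE.
apply/matrixP => i j; rewrite !mxE permKV.
by rewrite (inj_eq perm_inj).
Qed.

Lemma symmetric_sorted_diagonalization (R : rcfType) (n : nat) (A : 'M[R]_n) :
  A = A^T -> exists Q (a : 'rV[R]_n),
    [/\ Q *m Q^T = 1%:M, A = diag_conj Q a & nonincreasing a].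
Proof.
move=> /symmetric_diagonalization[Q [a [hQ AE]]].
have [s sa] := nonincreasing_perm a.
exists (perm_mx s *m Q), (col_perm s a).
split=> //.
  by apply: orthogonal_mul; rewrite // tr_perm_mx -perm_mxM mulgV perm_mx1.
by rewrite AE /diag_conj {1}(diag_mx_col_perm s a) trmx_mul !mulmxA.
Qed.

(** For dimension reasons the span of the first [i + 1] rows of [P] meets that of
    the rows of [Q] from index [i] on in a nonzero vector; there the first form is
    at least [a_i |v|^2] and the second at most [b_i |v|^2]. *)
Lemma le_eigenvalues (F : realFieldType) (n : nat) (P Q : 'M[F]_n)
    (a b : 'rV[F]_n) :
  P *m P^T = 1%:M -> Q *m Q^T = 1%:M -> nonincreasing a -> nonincreasing b ->
  (forall v : 'rV_n,
    (v *m diag_conj P a *m v^T) 0 0 <= (v *m diag_conj Q b *m v^T) 0 0) ->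
  forall i, a 0 i <= b 0 i.
Proof.
move=> hP hQ ha hb hab i.
pose V1 : 'M_n := pid_mx i.+1 *m P; pose V2 : 'M_n := copid_mx i *m Q.
have rk1 : \rank V1 = i.+1.
  rewrite /V1 mxrankMfree ?rank_pid_mx ?ltn_ord //.
  by rewrite row_free_unit; case: (mulmx1_unit hP).
have rk2 : \rank V2 = (n - i)%N.
  rewrite /V2 mxrankMfree ?(rank_copid_mx _ (ltnW (ltn_ord i))) //.
  by rewrite row_free_unit; case: (mulmx1_unit hQ).
have : (V1 :&: V2)%MS != 0.
  rewrite -mxrank_eq0 -lt0n; have := mxrank_sum_cap V1 V2; rewrite rk1 rk2 addSn.
  rewrite (subnKC (ltnW (ltn_ord i))) => e.
  by have := rank_leq_col (V1 + V2)%MS; lia.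
case/rowV0Pn => v; rewrite sub_capmx => /andP[/submxP[u1 v1] /submxP[u2 v2]] v0.
have p0 (j : 'I_n) : (i < j)%N -> (v *m P^T) 0 j = 0.
  move=> ij; rewrite v1 /V1 -!mulmxA hP mulmx1 mxE big1 // => k _; rewrite !mxE.
  case: eqP => //= [->|]; last by rewrite mulr0.
  by rewrite ltnS leqNgt ij mulr0.
have q0 (j : 'I_n) : (j < i)%N -> (v *m Q^T) 0 j = 0.
  move=> ji; rewrite v2 /V2 -!mulmxA hQ mulmx1 mxE big1 // => k _; rewrite !mxE.
  case: eqP => [->|] /=; last first.
    by move=> /eqP; rewrite val_eqE => /negPf ->; rewrite subrr mulr0.
  by rewrite ji eqxx subrr mulr0.
have nP (M : 'M[F]_n) : M *m M^T = 1%:M ->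
    (v *m v^T) 0 0 = \sum_j (v *m M^T) 0 j ^+ 2.
  move=> hM; rewrite -dotE trmx_mul trmxK mulmxA -(mulmxA v).
  by rewrite (mulmx1C hM) mulmx1.
rewrite -(ler_pM2r (dot_gt0 v0)) {1}(nP _ hP) (nP _ hQ) !mulr_sumr.
apply: le_trans (le_trans _ (hab v)) _; rewrite quad_diag_conj ler_sum // => j _.
  case: (leqP j i) => ji; last by rewrite p0 // expr0n !mulr0.
  by rewrite ler_wpM2r ?sqr_ge0 // ha.
case: (leqP i j) => ji; last by rewrite q0 // expr0n !mulr0.
by rewrite ler_wpM2r ?sqr_ge0 // hb.
Qed.

(** Li and Mathias' proof: replacing the perturbation [D] by [c + (D - c)^+],
    where [c] is the [#|I|]-th eigenvalue of [D], only increases the eigenvalues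
    of [A + D]; relative to [A + c] every eigenvalue then increases, so the sum
    over [I] is at most the sum over all indices, which is a trace. *)
Lemma lidskii (R : rcfType) (n : nat) (P Q W : 'M[R]_n) (a x d : 'rV[R]_n)
    (I : {set 'I_n}) :
  P *m P^T = 1%:M -> Q *m Q^T = 1%:M -> W *m W^T = 1%:M ->
  nonincreasing a -> nonincreasing x -> nonincreasing d ->
  diag_conj Q x = diag_conj P a + diag_conj W d ->
  \sum_(i in I) (x 0 i - a 0 i) <= \sum_(i < n | (i < #|I|)%N) d 0 i.
Proof.
move=> hP hQ hW ha hx hd xE.
have [I0|I0] := posnP #|I|.
  by rewrite (cards0_eq I0) big_set0 cards0 big_pred0.
have cI : (#|I|.-1 < n)%N.
  by rewrite prednK  // -[n in (_ <= n)%N]card_ord max_card.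
pose k := Ordinal cI; pose c := d 0 k.
have kE (i : 'I_n) : (i < #|I|)%N = (i <= k)%N.
  by rewrite -[#|I|]prednK .
(* With [D = diag_conj W d], the matrix [diag_conj W e] is the positive part of [D - c], so [B]
   dominates both [diag_conj Q x] and [diag_conj P a + c]. *)
pose e : 'rV[R]_n := \row_i Num.max (d 0 i - c) 0.
pose B := diag_conj P (a + const_mx c) + diag_conj W e.
have Bsym : B = B^T by rewrite /B [RHS]raddfD /= -!diag_conj_sym.
have [Z [b [hZ BE hb]]] := symmetric_sorted_diagonalization Bsym.
have xb i : x 0 i <= b 0 i.
  apply: (le_eigenvalues hQ hZ hx hb) => v.
  rewrite -BE /B xE diag_conjD diag_conj_const // -(diag_conj_const c hW).
  rewrite -addrA -diag_conjD !mulmxDr !mulmxDl mxE [leRHS]mxE lerD2l.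
  rewrite !quad_diag_conj ler_sum // => j _; rewrite ler_wpM2r ?sqr_ge0 //.
  by rewrite !mxE -lerBlDl le_max lexx.
have ab i : a 0 i + c <= b 0 i.
  have hac : nonincreasing (a + const_mx c).
    by move=> i' j ij; rewrite !mxE lerD2r ha.
  have := le_eigenvalues hP hZ hac hb _ i; rewrite !mxE; apply=> v.
  rewrite -BE /B [v *m (_ + _)]mulmxDr mulmxDl [leRHS]mxE lerDl.
  rewrite quad_diag_conj sumr_ge0 // => j _; rewrite mulr_ge0 ?sqr_ge0 //.
  by rewrite mxE le_max lexx orbT.
(* As [d] is sorted, [d 0 i - c] is nonnegative up to index [k] and nonpositive afterwards. *)
have eE : \sum_i e 0 i = \sum_(i < n | (i < #|I|)%N) (d 0 i - c).
  rewrite [RHS]big_mkcond; apply: eq_bigr => i _; rewrite mxE kE.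
  case: leqP => ik; last by rewrite max_r // subr_le0 hd // ltnW.
  by rewrite max_l // subr_ge0 hd.
have bE : \sum_i (b 0 i - (a 0 i + c)) = \sum_i e 0 i.
  have := congr1 mxtrace BE; rewrite /B mxtraceD !mxtrace_diag_conj // => bE.
  rewrite sumrB -bE addrC.
  rewrite (eq_bigr (fun i => (a + const_mx c) 0 i)) ?addKr // => i _.
  by rewrite !mxE.
apply: (@le_trans _ _ (\sum_(i in I) (b 0 i - (a 0 i + c) + c))).
  by apply: ler_sum => i _; rewrite opprD addrA subrK lerD2r.
have -> : \sum_(i < n | (i < #|I|)%N) d 0 i = \sum_i e 0 i + \sum_(i in I) c.
  rewrite eE sumrB.
  have -> : \sum_(i < n | (i < #|I|)%N) c = \sum_(i in I) c.
    rewrite -(big_ord_widen n (fun=> c)) ?sumr_const ?card_ord //.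
    by rewrite -[n in (_ <= n)%N]card_ord max_card.
  by rewrite subrK.
rewrite big_split /= lerD2r -bE [leRHS](bigID (mem I)) /= lerDl.
by rewrite sumr_ge0 // => i _; rewrite subr_ge0.
Qed.

(** * Majorization and convex symmetric functions *)

(** Induction on the number of indices where [d] and [v] differ: each round replaces [d] by an
    average of [d] and a transposed copy, where [phi] is no larger, until [v] is reached. The
    partial sums of [d] are taken in the given order because the averages need not stay sorted. *)
Lemma le_convex_majorized (F : realFieldType) (n : nat) (phi : 'rV[F]_n -> F)
    (v d : 'rV[F]_n) :
  (forall (s : {perm 'I_n}) u, phi (col_perm s u) = phi u) ->
  (forall (t : F) u w, 0 <= t <= 1 ->
     phi (t *: u + (1 - t) *: w) <= t * phi u + (1 - t) * phi w) ->
  nonincreasing v ->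
  (forall m, (m <= n)%N ->
    \sum_(i < n | (i < m)%N) v 0 i <= \sum_(i < n | (i < m)%N) d 0 i) ->
  \sum_i v 0 i = \sum_i d 0 i ->
  phi v <= phi d.
Proof.
move=> phiP phiC hv; have [N] := ubnP #|[set i | d 0 i != v 0 i]|.
elim: N d => // N IH d; rewrite ltnS => dN hvd svd.
have [/existsP[k0 hk0]|] := boolP [exists k, d 0 k < v 0 k]; last first.
  (* If [d] is nowhere below [v], equality of the total sums forces [d = v]. *)
  rewrite negb_exists => /forallP vd.
  suff -> : v = d by [].
  apply/rowP => i; apply/eqP; rewrite -subr_eq0 -oppr_eq0 opprB; apply/eqP.
  have := svd; move/eqP; rewrite eq_sym -subr_eq0 -sumrB psumr_eq0; last first.
    by move=> j _; rewrite subr_ge0 leNgt vd.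
  by move=> /allP/(_ i (mem_index_enum _)) /eqP.
(* A transfer of [delta] from index [j] to index [k] averages [d] with its image
   under the transposition [(j k)] and makes [d] and [v] agree at [j] or [k];
   the choice of [k] as the first index with [d_k < v_k] keeps the partial sums
   of [d] above those of [v]. *)
have [k dvk kmin] := arg_minnP (P := fun k => d 0 k < v 0 k) val hk0.
have vd (i : 'I_n) : (i < k)%N -> v 0 i <= d 0 i.
  by move=> ik; rewrite leNgt; apply: contraL ik => /kmin; rewrite -leqNgt.
(* Otherwise [d <= v] before [k], and the strict inequality at [k] contradicts the partial sums up
   to [k.+1]. *)
have [j jk vdj] : exists2 j : 'I_n, (j < k)%N & v 0 j < d 0 j.
  have [/existsP[j /andP[jk vdj]]|] :=
    boolP [exists j : 'I_n, (j < k)%N && (v 0 j < d 0 j)]; first by exists j.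
  rewrite negb_exists => /forallP h.
  have := hvd k.+1 (ltn_ord k); rewrite leNgt => /negP[].
  rewrite (bigD1 k) //= [ltRHS](bigD1 k) //= ltr_leD // ler_sum // => i.
  rewrite ltnS leq_eqVlt => /andP[/orP[/eqP/val_inj->|ik _]].
    by rewrite eqxx.
  by have := h i; rewrite ik /= -leNgt.
have vkj : v 0 k <= v 0 j by apply: hv; exact: ltnW.
have djk : 0 < d 0 j - d 0 k by rewrite subr_gt0; lra.
pose delta := Num.min (d 0 j - v 0 j) (v 0 k - d 0 k).
have delta_gt0 : 0 < delta by rewrite lt_min !subr_gt0 vdj.
have deltaj : delta <= d 0 j - v 0 j by rewrite ge_min lexx.
have deltak : delta <= v 0 k - d 0 k by rewrite ge_min lexx orbT.
pose t := delta / (d 0 j - d 0 k).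
have t01 : 0 <= t <= 1.
  by rewrite /t ler_pdivrMr // mul1r divr_ge0 ?(ltW djk) ?(ltW delta_gt0) //=; lra.
have tdelta : t * (d 0 j - d 0 k) = delta by rewrite divfK ?gt_eqF.
pose d' := t *: col_perm (tperm j k) d + (1 - t) *: d.
have d'j : d' 0 j = d 0 j - delta.
  by rewrite -tdelta !mxE tpermL; ring.
have d'k : d' 0 k = d 0 k + delta.
  by rewrite -tdelta !mxE tpermR; ring.
have d'i i : i != j -> i != k -> d' 0 i = d 0 i.
  by move=> ij ik; rewrite !mxE tpermD 1?eq_sym //; ring.
have sum_d' (p : pred 'I_n) : p j -> p k ->
    \sum_(i | p i) d' 0 i = \sum_(i | p i) d 0 i.
  move=> pj pk.
  have e : \sum_(i | p i) d 0 (tperm j k i) = \sum_(i | p i) d 0 i.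
    rewrite [RHS](reindex_inj (@perm_inj _ (tperm j k))) /=.
    by apply: eq_bigl => i; case: tpermP => // ->; rewrite pj pk.
  rewrite (eq_bigr (fun i => t * d 0 (tperm j k i) + (1 - t) * d 0 i)).
    by rewrite big_split /= -!mulr_sumr e; ring.
  by move=> i _; rewrite !mxE.
apply: (@le_trans _ _ (phi d')).
  apply: IH; last 2 first.
  (* An initial segment containing [k] also contains [j], so its sum is unchanged. One stopping
     before [k] has [v <= d'] entrywise, at [j] because [delta <= d 0 j - v 0 j]. *)
  - move=> m mn; have [km|mk] := ltnP k m.
      by rewrite sum_d' ?hvd // (ltn_trans jk).
    apply: ler_sum => i im; have ik : (i < k)%N := leq_trans im mk.
    have [->|ij] := eqVneq i j; first by rewrite d'j; lra.
    by rewrite d'i ?vd // -val_eqE ltn_eqF.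
  - by rewrite sum_d'.
  (* No agreement is lost, and the index attaining the minimum in [delta] becomes a new one. *)
  apply: leq_trans dN; apply: proper_card; apply/properP; split.
    apply/fintype.subsetP => i; rewrite !inE.
    have [->|ij] := eqVneq i j; first by rewrite (gt_eqF vdj).
    have [->|ik] := eqVneq i k; first by rewrite (lt_eqF dvk).
    by rewrite d'i.
  have [h|h] := leP (d 0 j - v 0 j) (v 0 k - d 0 k).
    exists j; rewrite !inE ?(gt_eqF vdj) // negbK d'j /delta min_l //.
    by apply/eqP; ring.
  exists k; rewrite !inE ?(lt_eqF dvk) // negbK d'k /delta min_r ?ltW //.
  by apply/eqP; ring.
apply: le_trans (phiC _ _ _ t01) _; rewrite phiP; lra.
Qed.

(** * Unitarily invariant norms and Mirsky's inequality *)

Lemma complexify_unitary (R : realType) (n : nat) (Q : 'M[R]_n) :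
  Q *m Q^T = 1%:M -> complexify Q \is unitarymx.
Proof.
move=> hQ; apply/unitarymxP.
have -> : ((complexify Q)^t*)%sesqui = complexify Q^T.
  apply/matrixP => i j; rewrite !mxE.
  by apply/eqP; rewrite eq_complex /= oppr0 !eqxx.
by rewrite /complexify -map_mxM hQ map_mx1.
Qed.

Section UnitarilyInvariantNorm.

Variables (R : realType) (n : nat) (N : 'M[R[i]]_n -> R).
Hypotheses (hN : is_matrix_norm N) (hNU : unitarily_invariant N).

Lemma norm_orthogonal (P M Q : 'M[R]_n) :
  P *m P^T = 1%:M -> Q *m Q^T = 1%:M ->
  N (complexify (P *m M *m Q)) = N (complexify M).
Proof.
by move=> hP hQ; rewrite /complexify !map_mxM hNU //; exact: complexify_unitary.
Qed.

Lemma norm_diag_conj (Q : 'M[R]_n) (a : 'rV[R]_n) :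
  Q *m Q^T = 1%:M ->
  N (complexify (diag_conj Q a)) = N (complexify (diag_mx a)).
Proof. by move=> hQ; rewrite norm_orthogonal ?trmxK // mulmx1C. Qed.

Lemma norm_diag_col_perm (s : {perm 'I_n}) (u : 'rV[R]_n) :
  N (complexify (diag_mx (col_perm s u))) = N (complexify (diag_mx u)).
Proof.
rewrite [in RHS](diag_mx_col_perm s) -/(diag_conj _ _) norm_diag_conj //.
by rewrite tr_perm_mx -perm_mxM mulgV perm_mx1.
Qed.

Lemma norm_diag_convex (t : R) (u w : 'rV[R]_n) : 0 <= t <= 1 ->
  N (complexify (diag_mx (t *: u + (1 - t) *: w))) <=
    t * N (complexify (diag_mx u)) + (1 - t) * N (complexify (diag_mx w)).
Proof.
case/andP=> t0 t1.
have normcE (r : R) : 0 <= r -> ComplexField.Normc.normc r%:C = r.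
  by move=> r0; rewrite /= expr0n addr0 sqrtr_sqr ger0_norm.
rewrite raddfD /= !linearZ /= /complexify map_mxD !map_mxZ.
apply: le_trans (matrix_norm_triangle hN _ _) _.
by rewrite !(matrix_norm_homogeneous hN) !normcE // subr_ge0.
Qed.

Lemma mirsky (P Q : 'M[R]_n) (a x : 'rV[R]_n) :
  P *m P^T = 1%:M -> Q *m Q^T = 1%:M -> nonincreasing a -> nonincreasing x ->
  N (complexify (diag_mx (x - a))) <=
    N (complexify (diag_conj Q x - diag_conj P a)).
Proof.
move=> hP hQ ha hx.
have Dsym : diag_conj Q x - diag_conj P a = (diag_conj Q x - diag_conj P a)^T.
  by rewrite [RHS]raddfB /= -!diag_conj_sym.
have [W [d [hW DE hd]]] := symmetric_sorted_diagonalization Dsym.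
have xE : diag_conj Q x = diag_conj P a + diag_conj W d.
  by rewrite -DE addrC subrK.
rewrite DE norm_diag_conj //.
(* A difference of sorted vectors need not be sorted; the norm on diagonal matrices ignores the
   order of the entries. *)
have [s hs] := nonincreasing_perm (x - a).
rewrite -(norm_diag_col_perm s).
apply: (le_convex_majorized (phi := fun u => N (complexify (diag_mx u)))) => //.
- exact: norm_diag_col_perm.
- exact: norm_diag_convex.
(* [I] collects the positions of the [m] largest entries of [x - a], so Lidskii's inequality for [I]
   is the [m]-th majorization inequality. *)
- move=> m mn; pose I := [set s i | i : 'I_n & (i < m)%N].
  have cI : #|I| = m.
    rewrite card_imset; last exact: perm_inj.
    rewrite -sum1dep_card -(big_ord_widen n (fun=> 1%N)) //.
    by rewrite sum_nat_const card_ord muln1.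
  have := lidskii I hP hQ hW ha hx hd xE; rewrite cI; apply: le_trans.
  rewrite big_imset /=; last by move=> i j _ _; exact: perm_inj.
  rewrite le_eqVlt; apply/orP; left; apply/eqP.
  by apply: eq_big => i; rewrite ?inE // !mxE.
- have := congr1 mxtrace xE; rewrite mxtraceD !mxtrace_diag_conj // => e.
  transitivity (\sum_i (x 0 i - a 0 i)); last by rewrite sumrB e addrC addKr.
  rewrite [RHS](reindex_inj (@perm_inj _ s)).
  by apply: eq_bigr => i _; rewrite !mxE.
Qed.

End UnitarilyInvariantNorm.

(** * Spectra and eigenbases of diagonal conjugates, and the optimal solution *)

Lemma Eig_char_poly (R : realType) (n : nat) (X Y : 'M[R]_n) :
  char_poly X = char_poly Y -> Eig X = Eig Y.
Proof. by move=> h; apply/fsfunP => a; rewrite !EigE h. Qed.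

(** Lifted to polynomial matrices, [Q] also conjugates the characteristic matrices, and the
    determinants of [Q] and its transpose cancel. *)
Lemma char_poly_diag_conj (F : fieldType) (n : nat) (Q : 'M[F]_n)
    (a : 'rV[F]_n) :
  Q *m Q^T = 1%:M -> char_poly (diag_conj Q a) = char_poly (diag_mx a).
Proof.
move=> hQ; rewrite /char_poly /char_poly_mx.
have hQ' : map_mx polyC Q^T *m map_mx polyC Q = 1%:M.
  by rewrite -map_mxM (mulmx1C hQ) map_mx1.
have -> : 'X%:M - map_mx polyC (diag_conj Q a) =
    map_mx polyC Q^T *m ('X%:M - map_mx polyC (diag_mx a)) *m map_mx polyC Q.
  rewrite mulmxBr mulmxBl /diag_conj !map_mxM; congr (_ - _).
  by rewrite mul_mx_scalar -scalemxAl hQ' scalemx1.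
by rewrite !det_mulmx mulrAC -det_mulmx hQ' det1 mul1r.
Qed.

Lemma orthogonal_basis (R : realType) (n : nat) (Q : 'M[R]_n) :
  Q *m Q^T = 1%:M -> orthonormal_basis [tuple (row i Q)^T | i < n].
Proof.
move=> hQ; set B := [tuple _ | i < n].
have BE i : tnth B i = (row i Q)^T by rewrite tnth_mktuple.
have Bo i j : ((tnth B i)^T *m tnth B j) 0 0 = (i == j)%:R.
  rewrite !BE trmxK.
  have /matrixP/(_ i j) := hQ; rewrite !mxE => <-.
  by apply: eq_bigr => k _; rewrite !mxE.
split=> //; clearbody B; rewrite basisEfree subvf size_tuple dimvf dim_matrix.
rewrite mulr1 leqnn !andbT.
apply/freeP => c c0 i.
(* Pairing a vanishing combination with the [i]-th vector leaves only the coefficient [c i]. *)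
have := congr1 (fun w => ((tnth B i)^T *m w) 0 0) c0.
rewrite mulmx0 mulmx_sumr summxE (bigD1 i) //= big1 ?addr0 => [|j ji].
  by rewrite -tnth_nth -scalemxAr mxE Bo eqxx mulr1 mxE.
by rewrite -tnth_nth -scalemxAr mxE Bo eq_sym (negPf ji) mulr0.
Qed.

Lemma eigenvector_diag_conj (R : realType) (n : nat) (Q : 'M[R]_n)
    (a : 'rV[R]_n) (i : 'I_n) :
  Q *m Q^T = 1%:M -> eigenvector (diag_conj Q a) (row i Q)^T.
Proof.
move=> hQ; have hQi : Q *m (row i Q)^T = (row i 1%:M)^T.
  by rewrite -[in LHS](trmxK Q) -trmx_mul -row_mul trmxK hQ.
split.
  apply/eqP => e; have := congr1 (fun M : 'cV_n => M i 0) hQi.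
  by rewrite e mulmx0 !mxE eqxx => /eqP; rewrite eq_sym oner_eq0.
exists (a 0 i); rewrite /diag_conj -(mulmxA _ Q) hQi.
have -> : Q^T *m diag_mx a = (diag_mx a *m Q)^T by rewrite trmx_mul tr_diag_mx.
rewrite -trmx_mul -row_mul mul1mx; apply/matrixP => k l.
by rewrite mul_diag_mx !mxE.
Qed.

Theorem theorem1 (R : realType) (n : nat) (A : 'M[R]_n)
    (N : 'M[R[i]]_n -> R) (S : set {mset R})
    (hA : A = A^T)
    (hN : is_matrix_norm N)
    (hNU : unitarily_invariant N)
    (hS : forall m : {mset R}, S m -> size m = n)
    (hopt : exists X : 'M[R]_n, optimal_solution N A S X) :
  exists Xhat : 'M[R]_n,
    optimal_solution N A S Xhat /\ same_eigenvectors Xhat A.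
Proof.
have [X [[SX Xsym] Xopt]] := hopt.
have [P [a [hP AE ha]]] := symmetric_sorted_diagonalization hA.
have [Q [x [hQ XE hx]]] := symmetric_sorted_diagonalization Xsym.
(* Attaching the eigenvalues of [X] to the eigenvectors of [A] in the same sorted order makes the
   distance to [A] equal to the norm of [diag_mx (x - a)], the lower bound in Mirsky's
   inequality. *)
exists (diag_conj P x); split.
  split.
    split; last exact: diag_conj_sym.
    by rewrite (@Eig_char_poly _ _ _ X) // XE !char_poly_diag_conj.
  move=> Y /Xopt; apply: le_trans.
  rewrite XE AE -diag_conjB norm_diag_conj //; exact: mirsky.
exists [tuple (row i P)^T | i < n]; first exact: orthogonal_basis.
move=> v /tnthP[i ->]; rewrite tnth_mktuple AE.
by split; exact: eigenvector_diag_conj.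
Qed.
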